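(* An integral domain $A$ is a GCD domain if and only if the direct product $A^A$ (the product of copies of $A$ indexed by the set $A$) is a PS $A$-module.
   Context: All rings are commutative and unitary. For an integral domain $A$, a torsion-free $A$-module $M$ is a PS module (pre-Schreier module) if every equality $ax=by$ with $a,b\in A-\{0\}$ and $x,y\in M-\{0\}$ has a refinement, i.e. there exist $c,d,e\in A$ and $z\in M$ with $a=ce$, $b=cd$, $x=dz$, $y=ez$. A GCD domain is a domain in which any two nonzero elements have a greatest common divisor. *)

(* Defs.v *)
From HB Require Import structures.
From mathcomp Require Import all_boot all_order all_algebra.
From mathcomp Require Import boolp classical_sets functions.
Set Implicit Arguments.
Unset Strict Implicit.
Unset Printing Implicit Defensive.
Import GRing.Theory.
Local Open Scope ring_scope.

Definition dvd (A : comNzRingType) (a b : A) : Prop := exists c : A, b = a * c.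

Definition is_gcd (A : comNzRingType) (a b g : A) : Prop :=
  [/\ dvd g a, dvd g b & forall d : A, dvd d a -> dvd d b -> dvd d g].

Definition gcd_domain (A : idomainType) : Prop :=
  forall a b : A, a != 0 -> b != 0 -> exists g : A, is_gcd a b g.

Definition torsion_free (A : idomainType) (M : lmodType A) : Prop :=
  forall (a : A) (x : M), a *: x = 0 -> a = 0 \/ x = 0.

Definition has_refinement (A : idomainType) (M : lmodType A)
    (a b : A) (x y : M) : Prop :=
  exists (c d e : A) (z : M), [/\ a = c * e, b = c * d, x = d *: z & y = e *: z].

Definition PS_module (A : idomainType) (M : lmodType A) : Prop :=
  torsion_free M /\
  forall (a b : A) (x y : M), a != 0 -> b != 0 -> x != 0 -> y != 0 ->
    a *: x = b *: y -> has_refinement a b x y.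

(* [A^o] is [A] as a module over itself; functions into a module carry the
   pointwise module structure of [functions], so this is the full direct
   product of copies of [A] indexed by [I]. *)
Definition power_module (A : idomainType) (I : Type) : lmodType A := (I -> A^o).

(* Main.v *)
From mathcomp Require Import all_boot all_order all_algebra.
From mathcomp Require Import boolp functions.
Require Import Defs.

Set Implicit Arguments.
Unset Strict Implicit.
Unset Printing Implicit Defensive.

Import GRing.Theory.
Local Open Scope ring_scope.

(** In a GCD domain, dividing [a *: x = b *: y] by [gcd a b] leaves coprime
    coefficients [e], [d] with [e *: x = d *: y], and Euclid's lemma makes [d]
    divide every coordinate of [x].  Conversely, for nonzero [a], [b], the
    index set [A] is large enough to list in one vector [x] all elements of the
    colon ideal [(b) : a].  A refinement [a = c * e], [b = c * d], [x = d *: z]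
    then makes [d] divide that whole ideal, in particular [b / t] for each
    common divisor [t] of [a] and [b], so that [t] divides [b / d = c]. *)

(** Let [h] be a gcd of [e * u] and [d * u]. Then [h = u * k] with [k] dividing [e] and [d]; as
    [g * k] divides [g], [k] is a unit. Since [d] divides both [d * v = e * u] and [d * u], it
    divides [h], hence [u]. *)
Lemma gcd_cofactor_dvd (A : idomainType) (g d e u v : A) :
  gcd_domain A -> g * e != 0 -> g * d != 0 -> is_gcd (g * e) (g * d) g ->
  e * u = d * v -> dvd d u.
Proof.
rewrite !mulf_eq0 !negb_or => gcdA /andP[g0 e0] /andP[_ d0] [_ _ gmax] euv.
have [->|u0] := eqVneq u 0; first by exists 0; rewrite mulr0.
have [h [[p hp] [q hq] hmax]] := gcdA _ _ (mulf_neq0 e0 u0) (mulf_neq0 d0 u0).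
have [k hk] : dvd u h by apply: hmax; [exists e | exists d]; rewrite mulrC.
have ek : e = k * p by apply: (mulIf u0); rewrite hp hk mulrC mulrA mulrC !mulrA.
have dk : d = k * q by apply: (mulIf u0); rewrite hq hk mulrC mulrA mulrC !mulrA.
have [w gw] : dvd (g * k) g.
  by apply: gmax; [exists p; rewrite ek mulrA | exists q; rewrite dk mulrA].
have kw : k * w = 1 by apply: (mulfI g0); rewrite mulrA -gw mulr1.
have [r hr] : dvd d h by apply: hmax; [exists v | exists u].
by exists (r * w); rewrite mulrA -hr hk -mulrA kw mulr1.
Qed.

Lemma power_module_torsion_free (A : idomainType) (I : Type) :
  torsion_free (power_module A I).
Proof.
move=> a x ax0; have [->|a0] := eqVneq a 0; [by left | right].
apply/funext => i; apply: (mulfI a0).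
by rewrite mulr0; exact: (congr1 (fun f : I -> A => f i) ax0).
Qed.

Lemma gcd_domain_power_PS (A : idomainType) (I : Type) :
  gcd_domain A -> PS_module (power_module A I).
Proof.
move=> gcdA; split; first exact: power_module_torsion_free.
move=> a b x y a0 b0 _ _ axby.
have [g gP] := gcdA _ _ a0 b0.
have [[e ae] [d bd] _] := gP.
rewrite ae in a0 axby gP; rewrite bd in b0 axby gP.
have [g0 e0] : g != 0 /\ e != 0 by move: a0; rewrite mulf_eq0 negb_or => /andP.
have d0 : d != 0 by move: b0; rewrite mulf_eq0 negb_or => /andP[].
have exdy i : e * x i = d * y i.
  apply: (mulfI g0); rewrite !mulrA.
  exact: (congr1 (fun f : I -> A => f i) axby).
have /choice[z xz] i : exists w, x i = d * w.
  exact: (gcd_cofactor_dvd gcdA a0 b0 gP (exdy i)).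
exists g, d, e, z; split=> //; apply/funext => i; first exact: xz.
by apply: (mulfI d0); rewrite -exdy xz mulrCA.
Qed.

Lemma power_PS_gcd_domain (A : idomainType) :
  PS_module (power_module A A) -> gcd_domain A.
Proof.
move=> [_ refine] a b a0 b0.
(* Each [i] in the colon ideal sits at its own index; elsewhere [(0, 0)] keeps the equation true. *)
have /choice[f fP] i : exists p : A * A,
    a * p.1 = b * p.2 /\ (dvd b (a * i) -> p.1 = i).
  case: (pselect (dvd b (a * i))) => [[j aibj]|nb]; first by exists (i, j).
  by exists (0, 0); rewrite !mulr0.
pose x : power_module A A := fun i => (f i).1.
pose y : power_module A A := fun i => (f i).2.
have xE i : dvd b (a * i) -> x i = i by case: (fP i).
have axby : a *: x = b *: y by apply/funext => i; case: (fP i).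
(* [b] itself lies in the colon ideal, so [x] is nonzero. *)
have xb : x b = b by apply: xE; exists a; rewrite mulrC.
have x0 : x != 0.
  by apply: contra_neq b0 => x0; rewrite -xb x0.
have y0 : y != 0.
  apply: contra_neq x0 => y0; move: axby; rewrite y0 scaler0.
  by case/power_module_torsion_free => // az; rewrite az eqxx in a0.
have [c [d [e [z [ace bcd xdz _]]]]] := refine _ _ _ _ a0 b0 x0 y0 axby.
exists c; split; [by exists e | by exists d | move=> t [a' ta] [b' tb]].
(* Here [b'] is [b / t], and [a * b' = b * a'] puts it in the colon ideal. *)
have b'E : b' = d * z b'.
  rewrite -[LHS]xE; first by rewrite {1}xdz.
  by exists a'; rewrite ta tb mulrAC.
have d0 : d != 0 by move: b0; rewrite bcd mulf_eq0 negb_or => /andP[].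
by exists (z b'); apply: (mulIf d0); rewrite -bcd tb {1}b'E mulrAC mulrA.
Qed.

Theorem corollary4p9 (A : idomainType) :
  gcd_domain A <-> PS_module (power_module A A).
Proof. by split; [exact: gcd_domain_power_PS | exact: power_PS_gcd_domain]. Qed.
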